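(* Let $\kappa, m\ge 1$ be integers. There exists a congestion-free routing strategy in the directed graph $\mathcal{B}_{clockwise}(\kappa,m)$ that takes $2m-1$ hops in the worst-case and at most $1.5m$ hops on average, in which $\pi=1$.
   Context: The $n$ nodes lie on a ring and are labeled $0,1,\dots,n-1$ according to their order on the ring; $x \bmod n$ always denotes an element of $[0,n-1]$, even when $x$ is negative or greater than $n-1$. Graph $\mathcal{B}_{clockwise}(\kappa,m)$ (defined for integers $\kappa,m\ge 1$): it has $n=\kappa^m m$ nodes. For a node $u$ let $\ell(u)=(m-1)-(u \bmod m)$. Each node has $\kappa$ links; for node $u$ these directed links are to the nodes $(u+x)\bmod n$, where $x\in\{1+i m\kappa^{\ell(u)} : i\in[0,\kappa-1]\}$ ($i$ an integer). A routing strategy specifies how a message travels from a source node to a target node along directed links of the graph (it need not be greedy); the number of hops of a route is the number of links traversed. For a routing strategy, $\pi$ denotes the ratio of the maximum and minimum loads on edges caused by all $\binom{n}{2}$ pairwise routes; ''congestion-free'' refers to the property $\pi=1$.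
   Formalization: For m=1 the links from a node to itself are not counted as edges (no 1-hop route between distinct nodes can load them, so π=1 would fail), and for κ=m=1 (a single node, no routes) the worst-case and π=1 claims are not asserted. *)

(* Defs.v *)
From mathcomp Require Import all_boot all_order all_algebra.

Set Implicit Arguments.
Unset Strict Implicit.
Unset Printing Implicit Defensive.

Import GRing.Theory Num.Theory.

Definition nnodes (k m : nat) : nat := k ^ m * m.

Definition level (m u : nat) : nat := m.-1 - u %% m.

(* The k values of i give k distinct nodes, so links can be identified with    *)
(* ordered pairs of nodes.                                                     *)
Definition link (k m : nat) : rel 'I_(nnodes k m) :=
  fun u v => [exists i : 'I_k,
    v == (u + (1 + i * m * k ^ level m u)) %% nnodes k m :> nat].

(* For m = 1 the link with i = k.-1 goes from u to u.  Such self-loops are not *)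
(* counted as edges: since the only route of at most 2m-1 = 1 hops between two *)
(* distinct nodes is then a single link, no self-loop could carry any load.    *)
(* For m >= 2 there are no self-loops.                                         *)
Definition edge (k m : nat) : pred ('I_(nnodes k m) * 'I_(nnodes k m)) :=
  fun e => (e.1 != e.2) && link e.1 e.2.

(* A routing strategy gives, for every source u and target v <> u, the nodes   *)
(* following u on the route to v.  The route is a walk: it may repeat nodes.   *)
Definition routing (k m : nat) : Type :=
  'I_(nnodes k m) -> 'I_(nnodes k m) -> seq 'I_(nnodes k m).

Definition routing_strategy (k m : nat) (r : routing k m) : Prop :=
  forall u v, u != v -> path (@link k m) u (r u v) /\ last u (r u v) = v.

Definition hops (k m : nat) (r : routing k m) (u v : 'I_(nnodes k m)) : nat :=
  size (r u v).

Definition worst_hops (k m : nat) (r : routing k m) : nat :=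
  \max_(p : 'I_(nnodes k m) * 'I_(nnodes k m) | p.1 != p.2) hops r p.1 p.2.

Definition average_hops (k m : nat) (r : routing k m) : rat :=
  ((\sum_(p : 'I_(nnodes k m) * 'I_(nnodes k m) | p.1 != p.2)
      hops r p.1 p.2)%N%:R /
   #|[pred p : 'I_(nnodes k m) * 'I_(nnodes k m) | p.1 != p.2]|%:R)%R.

Definition route_links (k m : nat) (r : routing k m) (u v : 'I_(nnodes k m)) :
    seq ('I_(nnodes k m) * 'I_(nnodes k m)) :=
  zip (u :: r u v) (r u v).

(* A route that traverses e several times contributes once per traversal.      *)
Definition load (k m : nat) (r : routing k m)
    (e : 'I_(nnodes k m) * 'I_(nnodes k m)) : nat :=
  \sum_(p : 'I_(nnodes k m) * 'I_(nnodes k m) | p.1 != p.2)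
    count_mem e (route_links r p.1 p.2).

Definition max_load (k m : nat) (r : routing k m) : nat :=
  \max_(e | @edge k m e) load r e.

(* Starting the minimum at max_load does not affect it when there is an edge.  *)
Definition min_load (k m : nat) (r : routing k m) : nat :=
  \big[minn/max_load r]_(e | @edge k m e) load r e.

(* Division by zero gives 0, so congestion r = 1 forces min_load r > 0.        *)
Definition congestion (k m : nat) (r : routing k m) : rat :=
  ((max_load r)%:R / (min_load r)%:R)%R.

Definition congestion_free (k m : nat) (r : routing k m) : Prop :=
  congestion r = 1%R.

(* Main.v *)
(* A route from u to v has two phases. With d = (v - u) mod m, the first d hops
   all use the same digit and end at a node w congruent to v modulo m; the
   remaining m hops run once through all levels, using for digits the base-k
   digits of (v - w)/m - 1 modulo k^m.

   For fixed digits, moving one hop is a permutation of the nodes. Hence if the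
   first-phase digit depends on v only, then w ranges over all nodes congruent
   to v as u does, and the second phases load all links equally. Only the case
   d = 0 deviates: there the pairs (v, v), whose second phase is the closed walk
   using k - 1 at each level, are missing, which costs each link with digit k - 1
   a load of m.

   This is repaired in the case d = 1, where the distribution of the first-phase
   digit can be chosen at will. To give k - 1 exactly the extra m, the total k^m
   has to be congruent to m modulo k, so m is first rounded up to a multiple of
   k: each v = 1 mod m is the head of k links; these k pairs (u, v) are routed
   through their link, and all but q of them then add the closed walk from v to
   v, where q = -m mod k. This makes the deficit m + q. *)
Require Import Defs.
From mathcomp Require Import all_boot all_order all_algebra.
From mathcomp Require Import zify.

Set Implicit Arguments.
Unset Strict Implicit.
Unset Printing Implicit Defensive.

Import Order.TTheory GRing.Theory Num.Theory.

(** * Sums over quotients, remainders and base-[k] digits *)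

Lemma sum_divn_modn (a b : nat) (F : nat -> nat -> nat) :
  \sum_(v < a * b) F (v %/ b) (v %% b) = \sum_(y < a) \sum_(r < b) F y r.
Proof.
rewrite -(big_mkord xpredT (fun v => F (v %/ b) (v %% b))) big_nat_mul big_mkord.
apply: eq_bigr => y _.
rewrite -[X in index_iota X _]add0n big_addn mulSn addnK big_mkord.
apply: eq_bigr => r _.
have b_gt0 : 0 < b by apply: leq_ltn_trans (ltn_ord r).
by rewrite addnC divnMDl // modnMDl divn_small // addn0 modn_small.
Qed.

Lemma sum_eq_nat (k i : nat) : i < k -> \sum_(j < k) (j == i :> nat) = 1.
Proof.
move=> ik; rewrite (bigD1 (Ordinal ik)) //= eqxx big1 // => j.
by rewrite -val_eqE /= => /negbTE->.
Qed.

Lemma sum_modn_eq (a k i : nat) : i < k -> \sum_(y < a * k) (y %% k == i) = a.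
Proof.
move=> ik; rewrite (sum_divn_modn a k (fun _ r => r == i)).
by rewrite sum_nat_const card_ord sum_eq_nat // muln1.
Qed.

Definition digit (k b l : nat) : nat := b %/ k ^ l %% k.

Lemma sum_digit_eq (k m l i : nat) :
  i < k -> l < m -> \sum_(b < k ^ m) (digit k b l == i) = k ^ m.-1.
Proof.
move=> ik lm; have -> : k ^ m = (k ^ (m.-1 - l) * k) * k ^ l.
  by rewrite -expnSr -expnD; congr (_ ^ _); lia.
rewrite (sum_divn_modn _ _ (fun y _ => y %% k == i)).
under eq_bigr => y _ do rewrite sum_nat_const card_ord.
by rewrite -big_distrr /= sum_modn_eq // -expnD; congr (_ ^ _); lia.
Qed.

Lemma sum_digits (k m b : nat) :
  0 < k -> \sum_(l < m) digit k b l * k ^ l = b %% k ^ m.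
Proof.
move=> k_gt0; elim: m => [|m IHm]; first by rewrite big_ord0 modn1.
rewrite big_ord_recr /= IHm /digit modn_divl -expnS addnC.
rewrite -(@modn_dvdm (k ^ m.+1) b (k ^ m)) ?dvdn_exp2l //.
by rewrite -divn_eq.
Qed.

Lemma digit_pred (k l x : nat) :
  0 < k -> 0 < x -> digit k (x * k ^ l.+1).-1 l = k.-1.
Proof.
move=> k_gt0 x_gt0; rewrite /digit.
have kl : 0 < k ^ l by rewrite expn_gt0 k_gt0.
have -> : (x * k ^ l.+1).-1 = (x * k).-1 * k ^ l + (k ^ l).-1.
  by rewrite expnS mulnA -[in LHS](@prednK (x * k)) ?muln_gt0 ?x_gt0 //; nia.
rewrite divnMDl // divn_small ?addn0; last by lia.
have -> : (x * k).-1 = x.-1 * k + k.-1 by nia.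
by rewrite modnMDl modn_small //; lia.
Qed.

(** * Translations and clockwise distances on the ring *)

Section Shift.

Variable n : nat.
Implicit Types u v w : 'I_n.

Lemma ord_bound_gt0 u : 0 < n. Proof. exact: leq_ltn_trans (ltn_ord u). Qed.

Definition shift u (c : nat) : 'I_n := Ordinal (ltn_pmod (u + c) (ord_bound_gt0 u)).

Definition dist u v : nat := (v + (n - u)) %% n.

Lemma ltn_dist u v : dist u v < n.
Proof. by rewrite ltn_pmod // (ord_bound_gt0 u). Qed.

Lemma shift_dist u v : shift u (dist u v) = v.
Proof.
apply: val_inj; rewrite /= modnDmr addnCA subnKC ?modnDr ?modn_small //.
exact: ltnW.
Qed.

Lemma dist_shift u c : dist u (shift u c) = c %% n.
Proof.
rewrite /dist /= modnDml -addnA addnCA subnKC ?modnDr //.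
exact: ltnW.
Qed.

Lemma shiftD u a b : shift (shift u a) b = shift u (a + b).
Proof. by apply: val_inj; rewrite /= modnDml addnA. Qed.

Lemma shift0 u : shift u 0 = u.
Proof. by apply: val_inj; rewrite /= addn0 modn_small. Qed.

Lemma eq_shift_mod u c c' : (shift u c == shift u c') = (c == c' %[mod n]).
Proof. by rewrite -val_eqE /= eqn_modDl. Qed.

Lemma shift_inj c : injective (fun u => shift u c).
Proof.
move=> u v /(congr1 val)/= /eqP; rewrite eqn_modDr => /eqP.
by rewrite !modn_small // => /val_inj.
Qed.

Lemma dist_shiftl u v a : dist (shift u a) v + a = dist u v %[mod n].
Proof. by rewrite -{2}(shift_dist (shift u a) v) shiftD dist_shift modn_mod addnC. Qed.

Lemma sum_shift u (F : 'I_n -> nat) : \sum_v F v = \sum_(s < n) F (shift u s).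
Proof.
have inj : injective (fun s : 'I_n => shift u s).
  move=> s s' /eqP; rewrite eq_shift_mod !modn_small // => /eqP; exact: val_inj.
by rewrite (reindex_inj inj).
Qed.

Lemma sum_pred1 (F : 'I_n -> 'I_n) u : injective F -> \sum_w (F w == u) = 1.
Proof.
move=> F_inj; transitivity (\sum_w (w == u : nat)); first by rewrite [RHS](reindex_inj F_inj).
by rewrite (bigD1 u) //= eqxx big1 // => w /negbTE->.
Qed.

End Shift.

(** * Walks whose digits depend only on the level *)

Section Walks.

Variables (k m : nat).
Hypotheses (k_gt0 : 0 < k) (m_gt0 : 0 < m).
Local Notation n := (nnodes k m).
Local Notation node := 'I_n.
Implicit Types (u v w p : node) (f : nat -> nat).

Lemma modn_shift u c : shift u c %% m = (u + c) %% m.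
Proof. by rewrite /= /nnodes modn_dvdm // dvdn_mull. Qed.

Lemma dist_modn u v : (u + dist u v) %% m = v %% m.
Proof. by rewrite -modn_shift shift_dist. Qed.

Lemma level_lt u : level m u < m.
Proof. by rewrite /level -[in X in _ < X](prednK m_gt0) ltnS leq_subr. Qed.

Lemma level_modn (a : nat) : level m (a %% m) = level m a.
Proof. by rewrite /level modn_mod. Qed.

Definition step u (i : nat) : node := shift u (1 + i * m * k ^ level m u).

Definition turn f u : node := step u (f (level m u)).

(** The displacements of the [k] links differ by less than [n], the level being at most m - 1. So a
    link determines its digit, and loads can be counted by node and digit. *)
Lemma step_inj u i j : i < k -> j < k -> step u i = step u j -> i = j.
Proof.
move=> ik jk /eqP; rewrite eq_shift_mod eqn_modDl.
have small a : a < k -> a * m * k ^ level m u < n.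
  move=> ak; apply: (@leq_trans (k * m * k ^ level m u)).
    by rewrite ltn_mul2r ltn_mul2r m_gt0 ak expn_gt0 k_gt0.
  rewrite /nnodes mulnAC leq_mul2r -expnS leq_pexp2l ?orbT //.
  exact: level_lt.
rewrite !modn_small ?small // !eqn_mul2r.
by rewrite expn_eq0 (gtn_eqF k_gt0) (gtn_eqF m_gt0) => /eqP.
Qed.

Lemma link_step u v :
  reflect (exists2 i, i < k & v = step u i) (link u v).
Proof.
apply: (iffP existsP) => [[i /eqP e]|[i ik ->]].
  by exists i => //; apply: val_inj.
by exists (Ordinal ik) => /=.
Qed.

Lemma turn_modn f u : turn f u %% m = u.+1 %% m.
Proof.
by rewrite /turn /step modn_shift addnA addn1 mulnAC -modnDmr modnMl addn0.
Qed.

Lemma iter_turn_modn f t u : iter t (turn f) u %% m = (u + t) %% m.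
Proof.
elim: t => [|t IHt] /=; first by rewrite addn0.
by rewrite turn_modn -addn1 -modnDml IHt modnDml addn1 addnS.
Qed.

(** A hop raises the residue modulo [m] by one, so nodes with equal images have equal levels; on a
    single level [turn f] is a translation. *)
Lemma turn_inj f : injective (turn f).
Proof.
move=> u v e; have eqm : u %% m = v %% m.
  have := turn_modn f u; rewrite e turn_modn -[u.+1]addn1 -[v.+1]addn1.
  by move/eqP; rewrite eqn_modDr => /eqP.
have eql : level m v = level m u by rewrite /level eqm.
by move: e; rewrite /turn /step eql => /shift_inj.
Qed.

Lemma iter_turn_inj f t : injective (iter t (turn f)).
Proof. by elim: t => [|t IHt] u v //= /turn_inj /IHt. Qed.

Lemma iter_turn f t u :
  iter t (turn f) u =
  shift u (\sum_(s < t) (1 + f (level m (u + s)) * m * k ^ level m (u + s))).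
Proof.
elim: t => [|t IHt] /=; first by rewrite big_ord0 shift0.
rewrite /turn /step -level_modn iter_turn_modn level_modn.
by rewrite IHt shiftD big_ord_recr.
Qed.

Lemma sum_level (G : nat -> nat) (u : nat) :
  \sum_(s < m) G (level m (u + s)) = \sum_(l < m) G l.
Proof.
(* The default [s] is never taken, since levels are below [m]. *)
pose h (s : 'I_m) : 'I_m := insubd s (level m (u + s)).
have hE s : h s = level m (u + s) :> nat.
  by rewrite /h insubdK // unfold_in /level; lia.
have h_inj : injective h.
  move=> s s' /(congr1 val) /=; rewrite !hE /level => e.
  have : (u + s) %% m = (u + s') %% m.
    by have := ltn_pmod (u + s) m_gt0; have := ltn_pmod (u + s') m_gt0; lia.
  by move/eqP; rewrite eqn_modDl !modn_small // => /eqP/val_inj.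
rewrite [RHS](reindex_inj h_inj); by apply: eq_bigr => s _; rewrite hE.
Qed.

Lemma iter_turn_full f u :
  iter m (turn f) u = shift u (m + (\sum_(l < m) f l * k ^ l) * m).
Proof.
rewrite iter_turn (sum_level (fun l => 1 + f l * m * k ^ l)).
rewrite big_split /= sum_nat_const card_ord muln1 big_distrl /=.
by congr (shift u (m + _)); apply: eq_bigr => l _; rewrite mulnAC.
Qed.

(** The endpoint is left out: only nodes from which a hop leaves count. *)
Definition visits f t u p : nat := \sum_(s < t) (iter s (turn f) u == p).

Lemma visits_sum f t p : \sum_u visits f t u p = t.
Proof.
rewrite exchange_big /= (eq_bigr (fun=> 1)) ?sum1_card ?card_ord // => s _.
by rewrite sum_pred1 //; apply: iter_turn_inj.
Qed.

(** For each time [s] exactly one start is at [p] after [s] hops, and its residue is that of p -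
    s. *)
Lemma visits_sum_modn f t p r :
  \sum_(u : node | u %% m == r %% m) visits f t u p = \sum_(s < t) (p == r + s %[mod m]).
Proof.
rewrite exchange_big /=; apply: eq_bigr => s _.
rewrite (eq_bigl (fun u => iter s (turn f) u %% m == (r + s) %% m)); last first.
  by move=> u; rewrite iter_turn_modn eqn_modDr.
transitivity (\sum_(w : node | w == r + s %[mod m]) (w == p : nat)).
  by rewrite [RHS](reindex_inj (@iter_turn_inj f s)).
rewrite big_mkcond (bigD1 p) //= eqxx big1 ?addn0; first by case: ifP.
by move=> w /negbTE->; case: ifP.
Qed.

Lemma visits_sum_class f p r :
  \sum_(u : node | u %% m == r %% m) visits f m u p = 1.
Proof.
(* This is p - r modulo [m], the only time below [m] at which a walk from the class of [r] can be at
   [p]. *)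
rewrite visits_sum_modn -(@sum_eq_nat m ((p + (m - r %% m)) %% m)) ?ltn_pmod //.
apply: eq_bigr => s _; congr (nat_of_bool _).
rewrite -(eqn_modDr (m - r %% m)) [r + s]addnC -addnA -[(s + _) %% m]modnDmr.
rewrite -(modnDml r) subnKC ?modnn ?addn0; last by rewrite ltnW // ltn_pmod.
by rewrite (modn_small (ltn_ord s)) eq_sym.
Qed.

Definition walk f t u : seq node := traject (turn f) (turn f u) t.

Lemma last_walk f t u : last u (walk f t u) = iter t (turn f) u.
Proof. by rewrite /walk last_traject. Qed.

Lemma size_walk f t u : size (walk f t u) = t. Proof. exact: size_traject. Qed.

Lemma path_walk f t u :
  (forall l, f l < k) -> path (@link k m) u (walk f t u).
Proof.
move=> fk; elim: t u => //= t IHt u; rewrite IHt andbT.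
by apply/link_step; exists (f (level m u)).
Qed.

Lemma count_walk f t u p i :
    (forall l, f l < k) -> i < k ->
  count_mem (p, step p i) (zip (u :: walk f t u) (walk f t u)) =
    visits f t u p * (f (level m p) == i).
Proof.
move=> fk ik; rewrite /visits; elim: t u => [|t IHt] u; first by rewrite big_ord0.
rewrite big_ord_recl mulnDl /= IHt; congr (_ + _).
  rewrite xpair_eqE mulnb; congr (nat_of_bool _).
  apply/andP/andP => -[/eqP up]; rewrite up; last first.
    by move=> /eqP <-; rewrite eqxx -up.
  by rewrite eqxx -{1}up => /eqP e; split=> //; apply/eqP; apply: (@step_inj p); rewrite // -e up.
congr (_ * _); apply: eq_bigr => s _; by rewrite -iterSr.
Qed.

End Walks.

(** * Second phases: words of [m] digits *)

Section Words.

Variables (k m : nat).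
Hypotheses (k_gt0 : 0 < k) (m_gt0 : 0 < m).
Local Notation n := (nnodes k m).
Local Notation node := 'I_n.
Implicit Types (u v w p : node).

Lemma expk_gt0 e : 0 < k ^ e. Proof. by rewrite expn_gt0 k_gt0. Qed.

Lemma eq_modn_dist u v : (u == v %[mod m]) = (m %| dist u v).
Proof. by rewrite -(dist_modn u v) -{1}[val u]addn0 eqn_modDl mod0n eq_sym. Qed.

Lemma dist0 u : dist u u = 0.
Proof. by rewrite -{2}(shift0 u) dist_shift mod0n. Qed.

(* [w + m + m * word w v = v] in the ring, when [w] and [v] agree modulo [m]. *)
Definition word w v : nat := (dist w v %/ m + (k ^ m).-1) %% k ^ m.

Lemma ltn_word w v : word w v < k ^ m.
Proof. by rewrite ltn_pmod // expk_gt0. Qed.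

Lemma shift_word w v : w = v %[mod m] -> shift w (m + word w v * m) = v.
Proof.
move/eqP; rewrite eq_modn_dist => /divnK e.
apply/eqP; rewrite -[X in _ == X](shift_dist w v) eq_shift_mod /word muln_modl modnDmr mulnDl e.
rewrite addnCA -mulSn prednK ?expk_gt0 //.
by rewrite /nnodes modnDr.
Qed.

Lemma word_shift w b : b < k ^ m -> word w (shift w (m + b * m)) = b.
Proof.
move=> bK; rewrite /word dist_shift /nnodes -mulSn -muln_modl mulnK //.
rewrite modnDml addSnnS prednK ?expk_gt0 // modnDr modn_small //.
Qed.

Lemma word_loop v : word v v = (k ^ m).-1.
Proof. by rewrite /word dist0 div0n modn_small // prednK ?expk_gt0. Qed.

(** [word w] is a bijection from the class of [w] onto the numbers below [k ^ m], with inverse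
    translation by m + b m. *)
Lemma sum_word w (F : nat -> nat) :
  \sum_(v : node | v == w %[mod m]) F (word w v) = \sum_(b < k ^ m) F b.
Proof.
rewrite (reindex_onto (fun b : 'I_(k ^ m) => shift w (m + b * m))
           (fun v => Ordinal (ltn_word w v))) => [|v /eqP e] /=; last first.
  by rewrite shift_word.
apply: eq_big => [b|b _]; last by rewrite word_shift.
rewrite modn_shift -mulSn addnC modnMDl.
by rewrite -val_eqE /= word_shift // !eqxx.
Qed.

Definition passes p (i : nat) w v : nat :=
  visits (digit k (word w v)) m w p * (digit k (word w v) (level m p) == i).

(** For a fixed word [b], the walks from all starts in the class visit [p] once in total, so only
    the digit of [b] at the level of [p] matters. *)
Lemma sum_passes_class p i r (P : pred nat) :
  \sum_(v : node | v == r %[mod m]) \sum_(w : node | (w == r %[mod m]) && P (word w v))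
     passes p i w v =
  \sum_(b < k ^ m | P b) (digit k b (level m p) == i).
Proof.
rewrite (exchange_big_dep (fun w : node => w == r %[mod m])) /=; last by move=> v w _ /andP[].
under eq_bigr => w /eqP wr.
  rewrite (eq_bigl (fun v : node => (v == w %[mod m]) && P (word w v))); last first.
    by move=> v; rewrite wr eqxx.
  rewrite big_mkcondr.
  rewrite (sum_word w (fun b => if P b then visits (digit k b) m w p *
    (digit k b (level m p) == i) else 0)).
  over.
rewrite exchange_big /= [RHS]big_mkcond /=; apply: eq_bigr => b _; case: (P b).
  by rewrite -big_distrl /= (visits_sum_class m_gt0) mul1n.
by rewrite big1.
Qed.

(** For each word the starts range over all nodes and visit [p] in total [m] times; [k ^ m.-1] words
    have digit [i] at the level of [p]. *)
Lemma sum_passes p i :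
    i < k ->
  \sum_(v : node) \sum_(w : node | w == v %[mod m]) passes p i w v = m * k ^ m.-1.
Proof.
move=> ik; rewrite (exchange_big_dep xpredT) //=.
under eq_bigr => w _.
  under eq_bigl => v do rewrite eq_sym.
  rewrite (sum_word w (fun b => visits (digit k b) m w p * (digit k b (level m p) == i))).
  over.
rewrite exchange_big /= -(sum_digit_eq ik (level_lt m_gt0 p)) big_distrr /=.
by apply: eq_bigr => b _; rewrite -big_distrl /= visits_sum.
Qed.

Lemma digit_loop l : l < m -> digit k (k ^ m).-1 l = k.-1.
Proof.
move=> lm; rewrite -{1}(subnK lm) expnD digit_pred //; exact: expk_gt0.
Qed.

Lemma sum_loops p i r :
  \sum_(v : node | v == r %[mod m]) passes p i v v = (i == k.-1).
Proof.
rewrite /passes; under eq_bigr => v _ do rewrite word_loop digit_loop ?level_lt //.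
by rewrite -big_distrl /= (visits_sum_class m_gt0) mul1n eq_sym.
Qed.

Lemma sum_loops_all p i : \sum_v passes p i v v = m * (i == k.-1).
Proof.
rewrite /passes; under eq_bigr => v _ do rewrite word_loop digit_loop ?level_lt //.
by rewrite -big_distrl /= visits_sum eq_sym.
Qed.

(** These [b] are y Q + Q - 1 with y < k: the top digit is free and all lower digits are k - 1. *)
Lemma sum_digit_coset l i : l < m -> i < k ->
  \sum_(b < k ^ m | k ^ m.-1 %| b.+1) (digit k b l == i) =
  if l == m.-1 then 1 else k * (i == k.-1).
Proof.
move=> lm ik; set Q := k ^ m.-1; have Q_gt0 : 0 < Q by apply: expk_gt0.
have -> : k ^ m = k * Q by rewrite /Q -expnS prednK.
rewrite big_mkcond /=.
pose F y r := if r == Q.-1 then (digit k (y * Q + r) l == i : nat) else 0.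
transitivity (\sum_(b < k * Q) F (b %/ Q) (b %% Q)).
  apply: eq_bigr => b _; rewrite /F -divn_eq.
  have -> : (Q %| b.+1) = (b %% Q == Q.-1) => //.
  rewrite {1}(divn_eq b Q) -addnS dvdn_addr ?dvdn_mull //.
  have bQ := ltn_pmod b Q_gt0; apply/idP/eqP => [/dvdn_leq|->]; last by rewrite prednK.
  by move=> /(_ isT); lia.
rewrite sum_divn_modn.
transitivity (\sum_(y < k) (digit k (y.+1 * Q).-1 l == i)).
  apply: eq_bigr => y _; rewrite -big_mkcond /=.
  have Q1 : Q.-1 < Q by rewrite prednK.
  rewrite (big_pred1 (Ordinal Q1)) => [|r]; last by rewrite /= -val_eqE.
  by rewrite /= mulSn; congr (nat_of_bool (digit _ _ _ == _)); lia.
case: eqP => [->|/eqP lm1].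
  rewrite -[RHS](sum_eq_nat ik); apply: eq_bigr => y _; rewrite /digit.
  have -> : (y.+1 * Q).-1 = y * Q + Q.-1 by rewrite mulSn; lia.
  by rewrite divnMDl // divn_small ?prednK // addn0 modn_small.
rewrite -(card_ord k) -sum_nat_const card_ord; apply: eq_bigr => y _.
have -> : y.+1 * Q = y.+1 * k ^ (m.-1 - l.+1) * k ^ l.+1.
  by rewrite -mulnA -expnD subnK //; lia.
by rewrite digit_pred ?muln_gt0 ?expk_gt0 // eq_sym.
Qed.

End Words.

(** * Criteria for congestion and for the average *)

Lemma card_neq_pairs n : #|[pred q : 'I_n * 'I_n | q.1 != q.2]| + n = n * n.
Proof.
have diag_inj : injective (fun u : 'I_n => (u, u)) by move=> u v [].
transitivity #|{: 'I_n * 'I_n}|; last by rewrite card_prod card_ord.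
rewrite -(cardC [pred q : 'I_n * 'I_n | q.1 != q.2]); congr (_ + _).
rewrite -[LHS](card_ord n) -(card_imset _ diag_inj).
apply: eq_card => -[u v]; rewrite !inE /= negbK; apply/imsetP/eqP.
  by case=> w _ [-> ->].
by move=> ->; exists v.
Qed.

Lemma sum_ord (m : nat) : 2 * \sum_(r < m) r = m * m.-1.
Proof. by elim: m => [|m IHm]; rewrite ?big_ord0 // big_ord_recr /= mulnDr IHm; nia. Qed.

Section Generic.

Variables (k m : nat) (r : routing k m).

(** The edge [e0] and [0 < L] exclude the ratio 0 / 0, whose value is 0. *)
Lemma congestion_free_const (L : nat) (e0 : 'I_(nnodes k m) * 'I_(nnodes k m)) :
    0 < L -> edge e0 -> (forall e, edge e -> load r e = L) -> congestion_free r.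
Proof.
move=> L_gt0 e0E loadE.
have maxE : max_load r = L.
  rewrite /max_load (eq_bigr (fun=> L)) //; apply/eqP; rewrite eqn_leq.
  by rewrite (@leq_bigmax_cond _ _ (fun=> L) e0) // andbT; apply/bigmax_leqP.
have minE : min_load r = L.
  rewrite /min_load maxE (eq_bigr (fun=> L)) //.
  by apply: (big_ind (fun x => x = L)) => // x y -> ->; rewrite minnn.
by rewrite /congestion_free /congestion maxE minE divff // pnatr_eq0 -lt0n.
Qed.

Lemma average_hops_le (N := #|[pred q : 'I_(nnodes k m) * 'I_(nnodes k m) | q.1 != q.2]|) :
  2 * (\sum_(q : 'I_(nnodes k m) * 'I_(nnodes k m) | q.1 != q.2) hops r q.1 q.2)
    <= 3 * m * N ->
  (average_hops r <= 3 / 2 * m%:R)%R.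
Proof.
rewrite /average_hops -/N; move: N (\sum_(q | _) _) => N S le_SN.
have [->|N_gt0] := posnP N; first by rewrite invr0 mulr0 !mulr_ge0 ?invr_ge0 ?ler0n.
have -> : (3 / 2 * m%:R = (3 * m)%:R / 2 :> rat)%R by rewrite natrM mulrAC.
rewrite ler_pdivrMr ?ltr0n // mulrAC -natrM ler_pdivlMr ?ltr0n //.
by rewrite -natrM ler_nat mulnC.
Qed.

End Generic.

Lemma sum_rot (J c : nat) (F : nat -> nat) :
  \sum_(r < J) F ((r + c) %% J) = \sum_(r < J) F r.
Proof. by rewrite [RHS](reindex_inj (@shift_inj J c)). Qed.

Lemma sum_eqn_modDr (m a b : nat) : 0 < m -> \sum_(r < m) (r + a == b %[mod m]) = 1.
Proof.
move=> m_gt0; rewrite (sum_rot m a (fun r => r == b %% m)).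
by rewrite sum_eq_nat // ltn_pmod.
Qed.

Lemma sum_dist n (v : 'I_n) (F : nat -> nat) :
  \sum_u F (dist u v) = \sum_(s < n) F s.
Proof.
have inj : injective (fun u => Ordinal (ltn_dist u v)).
  move=> u u' /(congr1 val) /= e.
  by apply: (@shift_inj _ (dist u v)); rewrite shift_dist e shift_dist.
by rewrite [RHS](reindex_inj inj).
Qed.

Lemma sum_leq_nat (k q : nat) : \sum_(a < k) (q <= a) = k - q.
Proof.
elim: k => [|k IHk]; first by rewrite big_ord0.
by rewrite big_ord_recr /= IHk; case: leqP; lia.
Qed.

(** * The routing for m at least 2 *)

Section Route.

Variables (k m : nat).
Hypotheses (k_gt0 : 0 < k) (m_gt1 : 1 < m).
Local Notation n := (nnodes k m).
Local Notation node := 'I_n.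
Implicit Types (u v w p : node).

Let m_gt0 : 0 < m := ltnW m_gt1.

Local Notation Q := (k ^ m.-1).
Local Notation J := (k ^ m.-1 * m).

Lemma nnodesE : n = k * J.
Proof. by rewrite /nnodes mulnA -expnS prednK. Qed.

Lemma J_gt1 : 1 < J. Proof. by have := expk_gt0 k_gt0 m.-1; nia. Qed.
Let J_gt0 : 0 < J := ltnW J_gt1.

(* The least multiple of [k] that is at least [m], i.e. m + q. *)
Definition pad : nat := (m + k.-1) %/ k * k.

Lemma pad_ge : m <= pad.
Proof.
by rewrite /pad; have := divn_eq (m + k.-1) k; have := ltn_pmod (m + k.-1) k_gt0; lia.
Qed.

Lemma pad_lt : pad < m + k.
Proof. by rewrite /pad; have := divn_eq (m + k.-1) k; lia. Qed.

Lemma pad_ge_k : k <= pad.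
Proof. by rewrite /pad -{1}[k]mul1n leq_mul2r divn_gt0 // orbC; lia. Qed.

(* If [1 < k], exactly [pad] more elements of [0, k ^ m) have the value [k - 1]
   than have any other given digit as value. *)
Definition bias (e : nat) : nat := if e < pad then k.-1 else e %% k.

Lemma bias_lt e : bias e < k.
Proof. by rewrite /bias; case: ifP => _; rewrite ?ltn_pmod // prednK. Qed.

Definition cls u v : nat := dist u v %% m.

(** Nodes [u = 0 mod m] have level m - 1, where the links have displacements 1 + i J: these are the
    pairs joined by such a link. *)
Definition direct u v : bool := (u %% m == 0) && (dist u v %% J == 1).

(* For [d = 1] and [u = 0 mod m], the argument of [bias] is chosen to be constant
   on the pairs (u, v) with v fixed and u fixed modulo [J], on which the hop
   permutes the [u], while it takes each value in [k, k ^ m) once when [u] is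
   fixed and [v] varies over the targets with no link from [u]. *)
Definition pre u v : nat :=
  if cls u v == 1 then
    if u %% m == 0 then
      if dist u v %% J == 1 then dist u v %/ J
      else bias (dist u v %% J %/ m * k + v %/ J)
    else bias (v %/ m)
  else (v %/ m) %% k.

Definition mid u v : node := iter (cls u v) (turn (fun=> pre u v)) u.

(** The q = [pad - m] direct pairs into [v] that do not add the closed walk. *)
Definition short u v : bool := direct u v && (dist u v %/ J < pad - m).

Definition route : routing k m := fun u v =>
  walk (fun=> pre u v) (cls u v) u ++
  if short u v then [::] else walk (digit k (word (mid u v) v)) m (mid u v).

Lemma cls_lt u v : cls u v < m. Proof. by rewrite ltn_pmod. Qed.

Lemma cls_eq d u v : d < m -> (cls u v == d) = (u + d == v %[mod m]).
Proof. by move=> dm; rewrite -(dist_modn u v) eqn_modDl (modn_small dm) eq_sym. Qed.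

Lemma pre_lt u v : pre u v < k.
Proof.
rewrite /pre; case: ifP => _; last by rewrite ltn_pmod.
case: ifP => _; last exact: bias_lt.
case: ifP => _; last exact: bias_lt.
by rewrite ltn_divLR // -nnodesE ltn_dist.
Qed.

Lemma direct_cls u v : direct u v -> cls u v = 1.
Proof.
case/andP=> _ /eqP e; rewrite /cls -(@modn_dvdm J) ?dvdn_mull // e.
by rewrite modn_small.
Qed.

Lemma step_level0 u i : u %% m = 0 -> step u i = shift u (1 + i * J).
Proof. by move=> u0; rewrite /step /level u0 subn0 -mulnA (mulnC m). Qed.

Lemma direct_mid u v : direct u v -> mid u v = v.
Proof.
move=> uv; have d1 := direct_cls uv; case/andP: uv => u0 J1.
rewrite /mid d1 /= /turn /pre d1 eqxx u0 J1 step_level0; last exact/eqP.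
by rewrite -(eqP J1) addnC -divn_eq shift_dist.
Qed.

Lemma mid_modn u v : mid u v = v %[mod m].
Proof. by rewrite iter_turn_modn /cls modnDmr dist_modn. Qed.

Lemma digit_lt b l : digit k b l < k. Proof. by rewrite ltn_pmod. Qed.

Lemma iter_word w v : w = v %[mod m] ->
  iter m (turn (digit k (word w v))) w = v.
Proof.
move=> wv; rewrite iter_turn_full // sum_digits // modn_small ?ltn_word //.
by rewrite shift_word.
Qed.

Lemma route_strategy : routing_strategy route.
Proof.
move=> u v _; rewrite /route cat_path last_cat last_walk -/(mid u v).
rewrite path_walk /= => [|_]; last exact: pre_lt.
case: ifP => [/andP[uv _]|_]; first by rewrite direct_mid.
rewrite last_walk iter_word ?mid_modn //; split=> //.
by apply: path_walk => // l; apply: digit_lt.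
Qed.

Lemma hops_route u v :
  hops route u v = cls u v + (if short u v then 0 else m).
Proof.
by rewrite /hops /route size_cat size_walk; case: ifP; rewrite ?size_walk.
Qed.

(** * Splitting the load of a link by phase *)

Definition pre_passes p i u v : nat :=
  visits (fun=> pre u v) (cls u v) u p * (pre u v == i).

Definition post_passes p i u v : nat :=
  if short u v then 0 else passes p i (mid u v) v.

Lemma zip_links_cat (T : Type) (x : T) s1 s2 :
  zip (x :: s1 ++ s2) (s1 ++ s2) =
  zip (x :: s1) s1 ++ zip (last x s1 :: s2) s2.
Proof. by elim: s1 x => [|y s1 IHs] x //=; rewrite -IHs. Qed.

Lemma count_route p i u v : i < k ->
  count_mem (p, step p i) (route_links route u v) =
  pre_passes p i u v + post_passes p i u v.
Proof.
move=> ik; rewrite /route_links /route zip_links_cat count_cat last_walk.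
rewrite count_walk //; last by move=> _; apply: pre_lt.
congr (_ + _); rewrite /post_passes; case: ifP => // _.
by rewrite count_walk // => l; apply: digit_lt.
Qed.

(** The sums on the right include u = v, where the first phase is empty and the second is the closed
    walk; these walks account for the extra term on the left. *)
Lemma load_route p i : i < k ->
  load route (p, step p i) + m * (i == k.-1) =
  \sum_v \sum_u pre_passes p i u v + \sum_v \sum_u post_passes p i u v.
Proof.
move=> ik; rewrite /load -(sum_loops_all k_gt0 m_gt0 p i) -big_split /=.
under [RHS]eq_bigr => v _ do rewrite -big_split /=.
rewrite [RHS]exchange_big /= [RHS]pair_big /= [RHS](bigID (fun q : node * node => q.1 != q.2)) /=.
congr (_ + _); first by apply: eq_bigr => q _; rewrite count_route.
rewrite -(pair_big_dep xpredT (fun u v => ~~ (u != v))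
  (fun u v => pre_passes p i u v + post_passes p i u v)) /=.
apply: eq_bigr => v _; rewrite (big_pred1 v) => [|w]; last by rewrite negbK eq_sym.
have c0 : cls v v = 0 by rewrite /cls dist0 mod0n.
rewrite /pre_passes /post_passes /short /direct /mid c0 dist0 mod0n andbF /=.
by rewrite /visits big_ord0.
Qed.

Lemma sum_cls v (F : node -> nat) :
  \sum_u F u = \sum_(d < m) \sum_(u : node | u + d == v %[mod m]) F u.
Proof.
rewrite (partition_big (fun u => Ordinal (cls_lt u v)) xpredT) //=.
by apply: eq_bigr => d _; apply: eq_bigl => u; rewrite -val_eqE /= cls_eq.
Qed.

Lemma modn_pred0 u v : u + 1 = v %[mod m] -> (u %% m == 0) = (v %% m == 1).
Proof.
move=> uv; rewrite -uv -{2}(modn_small m_gt1) -{2}[1]add0n eqn_modDr.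
by rewrite mod0n.
Qed.

(** * Load of the second phases *)

Definition fixed_digit d v : nat := if d == 1 then bias (v %/ m) else (v %/ m) %% k.

Lemma pre_fixed d u v : d < m -> (d == 1) && (v %% m == 1) = false ->
  u + d = v %[mod m] -> pre u v = fixed_digit d v /\ short u v = false.
Proof.
move=> dm dv /eqP uv; have /eqP c : cls u v == d by rewrite cls_eq.
rewrite /pre /short /fixed_digit c; case: eqP dv c uv => [->|d1] /= dv c uv.
  rewrite (modn_pred0 (eqP uv)) dv; split=> //.
  by rewrite /direct (modn_pred0 (eqP uv)) dv.
split=> //; apply/negP => /andP[/direct_cls e _].
by apply: d1; rewrite -c.
Qed.

Lemma sum_post_fixed p i d v : d < m -> (d == 1) && (v %% m == 1) = false ->
  \sum_(u : node | u + d == v %[mod m]) post_passes p i u v =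
  \sum_(w : node | w == v %[mod m]) passes p i w v.
Proof.
move=> dm dv; rewrite [RHS](reindex_inj (@iter_turn_inj k m (fun=> fixed_digit d v) d)).
apply: eq_big => u; first by rewrite iter_turn_modn.
move=> /eqP uv; have [preE shortE] := pre_fixed dm dv uv.
have /eqP c : cls u v == d by rewrite cls_eq //; apply/eqP.
by rewrite /post_passes shortE /mid preE c.
Qed.

Lemma sum_mulk_J (F : nat -> nat -> nat) :
  \sum_(s < n) F (s %/ J) (s %% J) = \sum_(a < k) \sum_(r < J) F a r.
Proof. by rewrite -sum_divn_modn -nnodesE. Qed.

(** The non-direct sources still have as [mid] each [w] with [J] not dividing [dist w v] once. The
    [k] direct sources all have [mid] equal to [v], and k - q of them add the closed walk. *)
Lemma sum_post_top p i v : v %% m = 1 ->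
  \sum_(u : node | u + 1 == v %[mod m]) post_passes p i u v +
    (\sum_(w : node | (w == v %[mod m]) && (J %| dist w v)) passes p i w v +
      (pad - m) * passes p i v v) =
  \sum_(w : node | w == v %[mod m]) passes p i w v + k * passes p i v v.
Proof.
move=> v1; have J1 := J_gt1.
rewrite (bigID (fun u => dist u v %% J == 1)) /=.
rewrite [in RHS](bigID (fun w => J %| dist w v)) /=.
set X := (X in X + _ + _ = _); set Y := (X in _ + X + _ = _).
set W := (X in _ = _ + X + _).
have -> : Y = W.
  (* [h] extends the non-direct case of [mid] to all nodes. Its digit depends on [u] only through
     [dist u v %% J], which can be recovered from [h u]; hence [h] is injective. *)
  pose h u : node := shift u (1 + bias (dist u v %% J %/ m * k + v %/ J) * J).
  have dist_h u : (dist (h u) v + 1) %% J = dist u v %% J.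
    have nJ : J %| n by rewrite nnodesE dvdn_mull.
    rewrite /h; set b := bias _.
    rewrite -(modn_dvdm (dist u v) nJ) -(dist_shiftl u v (1 + b * J)) modn_dvdm //.
    by rewrite addnA -[RHS]modnDmr modnMl addn0.
  have h_inj : injective h.
    move=> u u' e; have := dist_h u; rewrite e dist_h => e2.
    by move: e; rewrite /h e2 => /shift_inj.
  rewrite /W (reindex_inj h_inj) /=; apply: eq_big => [u|u /andP[uv uJ]].
    rewrite modn_shift; set b := bias _.
    have -> : (u + (1 + b * J)) %% m = (u + 1) %% m.
      by rewrite addnA mulnA [in LHS]addnC modnMDl.
    congr (_ && ~~ _); rewrite -dist_h -{2}(modn_small J1) -{2}[1]add0n eqn_modDr mod0n.
    by [].
  have u0 : u %% m == 0 by rewrite (modn_pred0 (eqP uv)) v1.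
  have c : cls u v = 1 by apply/eqP; rewrite cls_eq.
  have shortE : short u v = false by rewrite /short /direct (negbTE uJ) andbF.
  have midE : mid u v = h u.
    by rewrite /mid c /= /turn /pre c eqxx u0 (negbTE uJ) step_level0 //; apply/eqP.
  by rewrite /post_passes shortE midE.
have -> : X = (k - (pad - m)) * passes p i v v; last first.
  have := pad_lt; have := pad_ge; rewrite mulnBl; set L := passes p i v v.
  move=> h1 h2; have : (pad - m) * L <= k * L by rewrite leq_mul2r; lia.
  lia.
transitivity (\sum_(u : node) (dist u v %% J == 1) * (pad - m <= dist u v %/ J) * passes p i v v).
  rewrite /X [LHS]big_mkcond; apply: eq_bigr => u _.
  case: (boolP (dist u v %% J == 1)) => [uJ|_]; last by rewrite andbF.
  have uv : u + 1 == v %[mod m].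
    rewrite -cls_eq // /cls -(@modn_dvdm J) ?dvdn_mull // (eqP uJ).
    by rewrite modn_small.
  have d : direct u v by rewrite /direct uJ (modn_pred0 (eqP uv)) v1.
  rewrite uv /= /post_passes /short d direct_mid // mul1n ltnNge.
  by case: (_ <= _); rewrite ?mul1n.
rewrite -big_distrl /=; congr (_ * _).
rewrite (sum_dist v (fun s => (s %% J == 1) * (pad - m <= s %/ J))).
rewrite (sum_mulk_J (fun a r => (r == 1) * (pad - m <= a))).
under eq_bigr => a _ do rewrite -big_distrl /= sum_eq_nat // mul1n.
exact: sum_leq_nat.
Qed.

Lemma dvdn_J_word w v : w = v %[mod m] -> (J %| dist w v) = (Q %| (word w v).+1).
Proof.
move=> wv; have e : dist w v = ((word w v).+1 * m) %% n.
  by rewrite -(dist_shift w) mulSn shift_word.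
rewrite e /dvdn modn_dvdm; last by rewrite nnodesE dvdn_mull.
by rewrite -muln_modl muln_eq0 (gtn_eqF m_gt0) orbF.
Qed.

(** Each of the [m] values of d contributes [m * Q]. The corrections come from d = 1 and v = 1 mod
    m: the words with [Q %| b.+1] are lost, and k - q closed walks take their place. *)
Lemma sum_post p i : i < k ->
  \sum_v \sum_u post_passes p i u v +
    ((if level m p == m.-1 then 1 else k * (i == k.-1)) +
      (pad - m) * (i == k.-1)) =
  m * (m * Q) + k * (i == k.-1).
Proof.
move=> ik; rewrite -(sum_passes k_gt0 m_gt0 p ik).
pose N (v : node) := \sum_(w : node | w == v %[mod m]) passes p i w v.
pose T (v : node) := \sum_(w : node | (w == v %[mod m]) && (J %| dist w v)) passes p i w v.
have E : \sum_v \sum_u post_passes p i u v +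
    \sum_(v : node | v == 1 %[mod m]) (T v + (pad - m) * passes p i v v) =
    \sum_v m * N v + \sum_(v : node | v == 1 %[mod m]) k * passes p i v v.
  rewrite [in X in _ + X = _]big_mkcond [in X in _ = _ + X]big_mkcond -!big_split /=.
  apply: eq_bigr => v _; rewrite (sum_cls v) (bigD1 (Ordinal m_gt1)) //=.
  have -> : \sum_(d < m | d != Ordinal m_gt1)
      \sum_(u : node | u + d == v %[mod m]) post_passes p i u v = m.-1 * N v.
    rewrite (eq_bigr (fun=> N v)) => [|d d1]; last first.
      by apply: sum_post_fixed => //; move: d1; rewrite -val_eqE /= => /negbTE->.
    rewrite sum_nat_const; congr (_ * _).
    by have := cardC1 (Ordinal m_gt1); rewrite card_ord.
  have -> : m * N v = N v + m.-1 * N v by rewrite -mulSn prednK.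
  rewrite (modn_small m_gt1).
  case: eqP => [v1|v1]; last first.
    by rewrite !addn0 sum_post_fixed //=; apply/eqP.
  by rewrite addnAC sum_post_top // addnAC.
rewrite big_split /= -!big_distrr /= !(sum_loops k_gt0 m_gt0) in E.
suff e : \sum_(v : node | v == 1 %[mod m]) T v =
    if level m p == m.-1 then 1 else k * (i == k.-1).
  by rewrite -e E.
rewrite -(sum_digit_coset k_gt0 m_gt0 (level_lt m_gt0 p) ik).
rewrite -(sum_passes_class k_gt0 m_gt0 p i 1 (fun b => Q %| b.+1)).
apply: eq_bigr => v /eqP v1; apply: eq_bigl => w; rewrite v1.
by case: eqP => //= w1; rewrite dvdn_J_word // v1.
Qed.

(** * Load of the first phases *)

Lemma sum_residue a b (F : nat -> nat) :
  \sum_(v : node | v + a == b %[mod m]) F (v %/ m) = \sum_(y < k ^ m) F y.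
Proof.
rewrite big_mkcond.
transitivity (\sum_(v < k ^ m * m) (v %% m + a == b %[mod m]) * F (v %/ m)).
  by apply: eq_bigr => v _; rewrite modnDml; case: eqP; rewrite ?mul1n.
rewrite (sum_divn_modn _ _ (fun y r => (r + a == b %[mod m]) * F y)).
by apply: eq_bigr => y _; rewrite -big_distrl /= sum_eqn_modDr // mul1n.
Qed.

Lemma expkE : k ^ m = Q * k. Proof. by rewrite -expnSr prednK. Qed.

(** At each of the [d] times the targets whose walks are at [p] form one class modulo [m]; there
    [v %/ m] runs through all numbers below [k ^ m], of which [Q] have remainder [i]. *)
Lemma sum_pre_fixed p i d : i < k -> d < m -> d != 1 ->
  \sum_(v : node) \sum_(u : node | u + d == v %[mod m]) pre_passes p i u v = d * Q.
Proof.
move=> ik dm d1.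
(* [m - d + s] stands for s - d modulo [m]. *)
transitivity (\sum_(v : node) \sum_(s < d)
    (v + (m - d + s) == p %[mod m]) * (v %/ m %% k == i)).
  apply: eq_bigr => v _; rewrite -big_distrl /=.
  under [X in _ = X * _]eq_bigr => s _ do rewrite addnA eq_sym.
  rewrite -(visits_sum_modn (fun=> v %/ m %% k)) big_distrl /=.
  apply: eq_big => u; first by rewrite -[RHS](eqn_modDr d) -addnA subnK 1?ltnW // modnDr.
  move=> uv; have /eqP c : cls u v == d by rewrite cls_eq.
  by rewrite /pre_passes /pre c (negbTE d1).
rewrite exchange_big /= (eq_bigr (fun=> Q)) => [|s _].
  by rewrite sum_nat_const card_ord.
rewrite -(sum_modn_eq Q ik) -expkE.
rewrite -(sum_residue (m - d + s) p (fun y => y %% k == i)) [RHS]big_mkcond.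
by apply: eq_bigr => v _; case: (_ == _ %[mod m]); rewrite ?mul1n.
Qed.

Lemma sum_pre_one p i :
  \sum_(v : node) \sum_(u : node | u + 1 == v %[mod m]) pre_passes p i u v =
  \sum_(v : node | p + 1 == v %[mod m]) (pre p v == i).
Proof.
rewrite [RHS]big_mkcond; apply: eq_bigr => v _.
rewrite big_mkcond (bigD1 p) //= [X in _ + X]big1 ?addn0 => [|u up].
  case: ifP => // pv; have /eqP c : cls p v == 1 by rewrite cls_eq.
  by rewrite /pre_passes c /visits big_ord1 eqxx mul1n.
case: ifP => // uv; have /eqP c : cls u v == 1 by rewrite cls_eq.
by rewrite /pre_passes c /visits big_ord1 /= (negbTE up).
Qed.

Definition bias_count i : nat := \sum_(e < k ^ m) (bias e == i).

Lemma sum_pre_inner p i : p %% m != 0 ->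
  \sum_(v : node | p + 1 == v %[mod m]) (pre p v == i) = bias_count i.
Proof.
move=> p0; rewrite /bias_count -(sum_residue 0 (p + 1) (fun e => bias e == i)).
apply: eq_big => [v|v pv]; first by rewrite addn0 eq_sym.
have /eqP c : cls p v == 1 by rewrite cls_eq.
by rewrite /pre c eqxx (negbTE p0).
Qed.

(** The first block of [k] arguments lies below [pad], so [bias] is k - 1 on it. *)
Lemma bias_count_tail i :
  bias_count i =
  k * (i == k.-1) + \sum_(e < Q) \sum_(a < k) (e != 0 :> nat) * (bias (e * k + a) == i).
Proof.
rewrite /bias_count expkE.
under eq_bigr => e _ do rewrite {1}(divn_eq e k).
rewrite (sum_divn_modn Q k (fun e a => bias (e * k + a) == i)).
have Q_gt0 : 0 < Q by apply: expk_gt0.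
rewrite (bigD1 (Ordinal Q_gt0)) // [in RHS](bigD1 (Ordinal Q_gt0)) //=.
rewrite [X in _ = _ + (X + _)]big1 // add0n; congr (_ + _).
  rewrite (eq_bigr (fun=> (i == k.-1 : nat))) ?sum_nat_const ?card_ord // => a _.
  rewrite mul0n add0n /bias (leq_trans (ltn_ord a)) ?pad_ge_k //.
  by rewrite eq_sym.
apply: eq_bigr => e e0; apply: eq_bigr => a _.
by move: e0; rewrite -val_eqE /= => ->; rewrite mul1n.
Qed.

(** The direct targets use each digit once. For the other targets the arguments of [bias] fill [k, k
    ^ m), so the first block, worth [k] uses of digit k - 1, is missing. *)
Lemma sum_pre_top p i : i < k -> p %% m = 0 ->
  \sum_(v : node | p + 1 == v %[mod m]) (pre p v == i) + k * (i == k.-1) =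
  bias_count i + 1.
Proof.
move=> ik p0; rewrite bias_count_tail (bigID (fun v => dist p v %% J == 1)) /=.
set X := (X in X + _ + _ = _); set Y := (X in _ + X + _ = _).
set W := (X in _ = _ + X + _).
have J1 := J_gt1.
have Jn : J %| n by rewrite nnodesE dvdn_mull.
have mJ : m %| J by rewrite dvdn_mull.
have preE (v : node) : p + 1 == v %[mod m] -> pre p v =
    if dist p v %% J == 1 then dist p v %/ J
      else bias (dist p v %% J %/ m * k + v %/ J).
  move=> pv; have /eqP c : cls p v == 1 by rewrite cls_eq.
  by rewrite /pre c eqxx p0.
have pvE (v : node) : (p + 1 == v %[mod m]) = (dist p v %% J %% m == 1).
  by rewrite -cls_eq // modn_dvdm.
have -> : X = 1.
  rewrite -(sum_eq_nat ik) /X [LHS]big_mkcond (sum_shift p).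
  transitivity (\sum_(s < n) (s %% J == 1) * (s %/ J == i)).
    apply: eq_bigr => s _.
    have ds : dist p (shift p s) = s by rewrite dist_shift modn_small.
    case: ifP => [/andP[pv]|]; first by rewrite preE // ds => ->; rewrite mul1n.
    by rewrite pvE ds; case: (s %% J =P 1) => //= ->; rewrite modn_small.
  rewrite (sum_mulk_J (fun a r => (r == 1) * (a == i))).
  by apply: eq_bigr => a _; rewrite -big_distrl /= sum_eq_nat // mul1n.
suff -> : Y = W by lia.
(* For fixed [v %/ J], adding [c] rotates the residues modulo [J], so [dist p v %% J] takes each
   value once. *)
pose c := n - p.
rewrite /Y [LHS]big_mkcond /=.
pose G a r := (r %% m == 1) * (r != 1) * (bias (r %/ m * k + a) == i).
transitivity (\sum_(v < n) G (v %/ J) ((v %% J + c) %% J)).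
  apply: eq_bigr => v _; have -> : (v %% J + c) %% J = dist p v %% J.
    by rewrite modnDml /dist modn_dvdm.
  rewrite /G -pvE; case: ifP => [/andP[pv d1]|].
    by rewrite preE // (negbTE d1) pv /=; lia.
  by case: (_ == _ %[mod m]) => //= ->.
rewrite (sum_mulk_J (fun a r => G a ((r + c) %% J))).
under eq_bigr => a _ do rewrite (sum_rot J c (G a)).
rewrite /W [RHS]exchange_big /=; apply: eq_bigr => a _.
transitivity (\sum_(r < Q * m) (r %% m == 1) * ((r %/ m != 0) * (bias (r %/ m * k + a) == i))).
  apply: eq_bigr => r _; rewrite /G mulnA; case: (r %% m =P 1) => // r1.
  congr (_ * nat_of_bool (~~ _) * _).
  by rewrite {1}(divn_eq r m) r1 -[X in _ == X]add0n eqn_add2r muln_eq0 (gtn_eqF m_gt0) orbF.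
rewrite (sum_divn_modn Q m (fun e r => (r == 1) * ((e != 0) * (bias (e * k + a) == i)))).
by apply: eq_bigr => e _; rewrite -big_distrl /= sum_eq_nat // mul1n.
Qed.

Lemma sum_pre p i : i < k ->
  \sum_v \sum_u pre_passes p i u v + (if level m p == m.-1 then k * (i == k.-1) else 0) =
  \sum_(d < m | d != 1 :> nat) d * Q + bias_count i + (level m p == m.-1).
Proof.
move=> ik; under eq_bigr => v _ do rewrite (sum_cls v).
rewrite exchange_big /= (bigD1 (Ordinal m_gt1)) //= sum_pre_one.
have -> : \sum_(d < m | d != Ordinal m_gt1)
   \sum_(v : node) \sum_(u : node | u + d == v %[mod m]) pre_passes p i u v =
   \sum_(d < m | d != 1 :> nat) d * Q.
  by apply: eq_bigr => d d1; apply: sum_pre_fixed.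
have -> : (level m p == m.-1) = (p %% m == 0).
  by rewrite /level; have := ltn_pmod p m_gt0; lia.
case: eqP => [p0|/eqP p0]; last by rewrite sum_pre_inner // !addn0 addnC.
by rewrite addnAC sum_pre_top // addnC addnA.
Qed.

(** At level m - 1 the deviations of the two phases cancel each other; at lower levels those of the
    second phases cancel among themselves. What remains is the deficit m + q for digit k - 1. *)
Lemma load_routeE p i : i < k ->
  load route (p, step p i) + pad * (i == k.-1) =
  m * (m * Q) + \sum_(d < m | d != 1 :> nat) d * Q + bias_count i.
Proof.
move=> ik; have := load_route p ik.
have := sum_post p ik; have := sum_pre p ik.
have := pad_ge; rewrite mulnBl.
move=> h; have : m * (i == k.-1) <= pad * (i == k.-1) by rewrite leq_mul2r h orbT.
by case: (level m p == m.-1); lia.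
Qed.

Lemma pad_le : 1 < k -> pad <= k ^ m.
Proof.
move=> k_gt1; have h : k * m <= k ^ m.
  rewrite expkE mulnC leq_mul2r; apply/orP; right.
  by have := ltn_expl m.-1 k_gt1; lia.
(* m + k - 1 is at most k m because (k - 1)(m - 1) is nonnegative. *)
apply: leq_trans h; have := pad_lt; nia.
Qed.

(** Both [pad] and [k ^ m] are multiples of [k], so beyond [pad] all digits are equally frequent.
    The excess of digit k - 1 is exactly the deficit in [load_routeE]. *)
Lemma bias_countE i : 1 < k -> i < k ->
  bias_count i = pad * (i == k.-1) + (k ^ m - pad) %/ k.
Proof.
move=> k_gt1 ik; have h := pad_le k_gt1; rewrite /bias_count.
rewrite -(big_mkord xpredT (fun e => (bias e == i : nat))) (@big_cat_nat _ _ _ pad) //=.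
congr (_ + _).
  rewrite big_mkord (eq_bigr (fun=> (i == k.-1 : nat))) ?sum_nat_const ?card_ord //.
  by move=> e _; rewrite /bias ltn_ord eq_sym.
rewrite -[X in index_iota X _]add0n big_addn big_mkord.
have e : k ^ m - pad = (Q - (m + k.-1) %/ k) * k by rewrite mulnBl -expkE.
rewrite e mulnK // -[RHS](sum_modn_eq _ ik); apply: eq_bigr => y _.
by rewrite /bias ltnNge leq_addl /= /pad addnC modnMDl.
Qed.

Lemma load_const p i p' i' : i < k -> i' < k ->
  load route (p, step p i) = load route (p', step p' i').
Proof.
move=> ik ik'; have := load_routeE p ik; have := load_routeE p' ik'.
(* For k = 1 the bound [pad <= k ^ m] fails, but all links have digit 0 and hence the same
   deficit. *)
have [k_gt1|k_le1] := ltnP 1 k; first by rewrite !bias_countE //; lia.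
have i0 : i = 0 by move: ik k_le1; case: (i) => //; case: (k) => [|[]].
have i'0 : i' = 0 by move: ik' k_le1; case: (i') => //; case: (k) => [|[]].
by rewrite i0 i'0; lia.
Qed.

Lemma load_gt0 p i : i < k -> 0 < load route (p, step p i).
Proof.
move=> ik; have := load_routeE p ik; have Q0 := expk_gt0 k_gt0 m.-1.
have [k_gt1|k_le1] := ltnP 1 k; first by rewrite bias_countE //; nia.
(* For k = 1 the deficit is at most [m], hence below [m * m]. *)
have := pad_lt; have -> : i == k.-1 by lia.
nia.
Qed.

(** * Congestion and hop counts of the routing *)

Lemma nnodes_gt1 : 1 < n.
Proof. by apply: leq_trans m_gt1 _; rewrite /nnodes leq_pmull // expk_gt0. Qed.

Lemma route_congestion_free : congestion_free route.
Proof.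
pose u : 'I_n := Ordinal (ltnW nnodes_gt1).
apply: (congestion_free_const (e0 := (u, step u 0)) (load_gt0 u k_gt0)).
  rewrite /edge /=; apply/andP; split; last by apply/link_step; exists 0.
  by rewrite -val_eqE /= mul0n addn0 modn_small ?nnodes_gt1.
move=> [p v] /andP[_ /link_step[i ik /= ->]].
exact: load_const.
Qed.

Lemma route_worst_hops : worst_hops route = 2 * m - 1.
Proof.
apply/eqP; rewrite eqn_leq; apply/andP; split.
  apply/bigmax_leqP => q _; rewrite hops_route.
  move: (cls q.1 q.2) (cls_lt q.1 q.2) => c cm.
  by case: ifP => _; lia.
(* The maximum is attained from node 1 to node 0: the distance n - 1 is m - 1 modulo [m], and node 1
   starts no direct pair. *)
pose u : 'I_n := Ordinal nnodes_gt1.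
pose v : 'I_n := Ordinal (ltnW nnodes_gt1).
apply: leq_trans (leq_bigmax_cond (u, v) _) => //=.
have u1 : u %% m = 1 by rewrite modn_small.
have -> : hops route u v = cls u v + m.
  by rewrite hops_route /short /direct u1.
suff /eqP-> : cls u v == m.-1 by lia.
rewrite cls_eq //; last by rewrite prednK.
by rewrite /= add1n prednK // modnn mod0n.
Qed.

(** Every route has at most d + m hops, which averages (3m - 1)/2 over all ordered pairs, the
    diagonal included. Removing the [n] diagonal pairs, with d + m = m, keeps the average below 3m/2
    because m is at most [n]. *)
Lemma route_average_hops : (average_hops route <= 3 / 2 * m%:R)%R.
Proof.
apply: average_hops_le; have := card_neq_pairs n; set N := #|_| => NE.
set S := \sum_(q | _) _.
have le_S : S + n * m <= n * (k ^ m * (\sum_(r < m) r) + n * m).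
  have <- : \sum_(v : 'I_n) \sum_(u : 'I_n) (cls u v + m) =
            n * (k ^ m * (\sum_(r < m) r) + n * m).
    rewrite (eq_bigr (fun=> k ^ m * (\sum_(r < m) r) + n * m)) => [|v _].
      by rewrite sum_nat_const card_ord.
    rewrite big_split /= sum_nat_const card_ord; congr (_ + _).
    rewrite (sum_dist v (fun s => s %% m)) (sum_divn_modn _ _ (fun _ r => r)).
    by rewrite sum_nat_const card_ord.
  rewrite exchange_big pair_big /= [X in _ <= X](bigID (fun q => q.1 != q.2)) /=.
  apply: leq_add; first by apply: leq_sum => q _; rewrite hops_route leq_add2l; case: ifP.
  rewrite -(pair_big_dep xpredT (fun u v => ~~ (u != v)) (fun u v => cls u v + m)) /=.
  rewrite -{1}(card_ord n) -sum_nat_const; apply: leq_sum => u _.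
  by rewrite (big_pred1 u) ?leq_addl // => w; rewrite negbK eq_sym.
have := sum_ord m; have : m <= n by rewrite /nnodes leq_pmull ?expk_gt0.
have : n = k ^ m * m by []; move: NE le_S.
move: N S (\sum_(r < m) r) (k ^ m) (n) => N S G K M NE le_S nE le_mM G2.
have e1 : 2 * (M * (K * G)) + M * M = M * M * m.
  transitivity (M * K * (m * m.-1 + m)); first by rewrite -G2 [in X in _ + X]nE; lia.
  by rewrite -mulnSr prednK // mulnA -(mulnA M K) -nE.
have e2 : M * m <= M * M by rewrite leq_mul2l le_mM orbT.
have e3 : 3 * m * N + 3 * m * M = 3 * m * (M * M) by rewrite -NE mulnDr.
rewrite mulnDr in le_S; lia.
Qed.

End Route.

(** * The case m = 1, a complete graph *)

Section OneLevel.

Variable k : nat.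
Local Notation n := (nnodes k 1).

Definition direct_route : routing k 1 := fun _ v => [:: v].

Lemma link_direct (u v : 'I_n) : u != v -> link u v.
Proof.
move=> uv; have d0 : 0 < dist u v.
  rewrite lt0n; apply/eqP => d0; move/eqP: uv; apply.
  by rewrite -(shift_dist u v) d0 shift0.
apply/link_step; exists (dist u v).-1.
  rewrite prednK //; apply: leq_trans (ltnW (ltn_dist u v)) _.
  by rewrite /nnodes muln1 expn1.
by rewrite /step /level modn1 expn0 !muln1 add1n prednK // shift_dist.
Qed.

Lemma direct_route_strategy : routing_strategy direct_route.
Proof. by move=> u v uv; rewrite /= link_direct. Qed.

Lemma direct_worst_hops : 1 < n -> worst_hops direct_route = 1.
Proof.
move=> n_gt1; apply/eqP; rewrite eqn_leq; apply/andP; split; first by apply/bigmax_leqP.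
by apply: leq_trans (leq_bigmax_cond (Ordinal (ltnW n_gt1), Ordinal n_gt1) _).
Qed.

Lemma direct_average_hops : (average_hops direct_route <= 3 / 2 * 1%:R)%R.
Proof.
by apply: average_hops_le; rewrite sum_nat_const muln1 leq_mul2r orbT.
Qed.

(** Each edge is used only by the route between its own endpoints. *)
Lemma direct_congestion_free : 1 < n -> congestion_free direct_route.
Proof.
move=> n_gt1; have uv : Ordinal (ltnW n_gt1) != Ordinal n_gt1 by [].
apply: (congestion_free_const (L := 1) (e0 := (Ordinal (ltnW n_gt1), Ordinal n_gt1))) => //.
  by rewrite /edge /= link_direct.
move=> e /andP[e12 _]; rewrite /load (bigD1 e) //= big1 => [|q /andP[_ qe]].
  by rewrite -surjective_pairing eqxx.
by rewrite -surjective_pairing (negbTE qe).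
Qed.

End OneLevel.

Theorem theorem5 (k m : nat) (hk : 0 < k) (hm : 0 < m) :
  exists r : routing k m,
    [/\ routing_strategy r,
        1 < nnodes k m -> worst_hops r = 2 * m - 1,
        (average_hops r <= 3 / 2 * m%:R)%R
      & 1 < nnodes k m -> congestion_free r].
Proof.
case: m hm => [|[|m]] // _.
  exists (@direct_route k); split.
  - exact: direct_route_strategy.
  - exact: direct_worst_hops.
  - exact: direct_average_hops.
  - exact: direct_congestion_free.
exists (@route k m.+2); split.
- exact: route_strategy.
- by move=> _; apply: route_worst_hops.
- exact: route_average_hops.
- by move=> _; apply: route_congestion_free.
Qed.
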